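(* Let $X\subset\mathbb{R}^d$ and let $h_1,\dots,h_r:X\to\mathbb{R}$ be arbitrarily fixed functions. Then $\mathcal{B}(h_1,\dots,h_r;X)=T(X)$ if and only if $X$ contains no cycles with respect to the functions $h_1,\dots,h_r$.
   Context: $T(X)$ is the set of all functions $X\to\mathbb{R}$, and $$\mathcal{B}(h_1,\dots,h_r;X)=\Big\{x\mapsto\sum_{i=1}^r g_i(h_i(x)),\ x\in X:\ g_i:\mathbb{R}\to\mathbb{R},\ i=1,\dots,r\Big\}$$ (the $g_i$ are arbitrary functions). For a real number $a$, $\delta_a:\mathbb{R}\to\mathbb{R}$ denotes the characteristic function of the one-point set $\{a\}$. A finite set of (distinct) points $\{x_1,\dots,x_n\}\subset X$ is called a cycle with respect to $h_1,\dots,h_r$ if there is a vector $\lambda=(\lambda_1,\dots,\lambda_n)$ with all coordinates nonzero real numbers such that $\sum_{j=1}^n\lambda_j\delta_{h_i(x_j)}=0$ for every $i=1,\dots,r$. *)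

(* Defs.v *)
From mathcomp Require Import all_boot all_order all_algebra.
From mathcomp Require Import all_classical all_reals all_analysis.

Set Implicit Arguments.
Unset Strict Implicit.
Unset Printing Implicit Defensive.

Import GRing.Theory.
Local Open Scope classical_set_scope.
Local Open Scope ring_scope.

(* Functions on X are functions on the subtype [set_type X], to which sets
   coerce; thus T(X) is [[set: X -> R]]. *)

Definition superpositions (R : realType) (d r : nat) (X : set 'rV[R]_d)
    (h : 'I_r -> X -> R) : set (X -> R) :=
  [set f | exists g : 'I_r -> R -> R, f = fun x : X => \sum_(i < r) g i (h i x)].

(* The condition [0 < n] excludes the empty set, which would otherwise be a
   cycle vacuously. *)
Definition is_cycle (R : realType) (d r : nat) (X : set 'rV[R]_d)
    (h : 'I_r -> X -> R) (C : set X) : Prop :=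
  exists (n : nat) (x : 'I_n -> X) (lambda : 'I_n -> R),
    [/\ (0 < n)%N, injective x, C = range x, forall j, lambda j != 0 &
        forall i : 'I_r,
          (fun t : R => \sum_(j < n) lambda j * \1_[set h i (x j)] t) = cst 0].

(* Main.v *)
Require Import Defs.
From mathcomp Require Import all_boot all_order all_algebra.
From mathcomp Require Import all_classical all_reals all_analysis.

Set Implicit Arguments.
Unset Strict Implicit.
Unset Printing Implicit Defensive.

Import GRing.Theory.
Local Open Scope classical_set_scope.
Local Open Scope ring_scope.

(* A representation f = sum_i g_i o h_i is a solution of the linear system with
   unknowns u = (i, t) (the value g_i t) and one equation per point of X, each
   equation involving finitely many unknowns.  Without cycles, the equations
   are linearly independent.  By Zorn's lemma there is a maximal set D of
   unknowns on which no nontrivial combination of equations is supported.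
   By maximality every unknown u outside D is, modulo the unknowns in D, the
   left-hand side of a combination of equations; give u the value of the
   right-hand side of that combination and give the unknowns in D the value 0.
   The equation at x minus the combinations attached to its unknowns is
   supported on D, hence trivial, so the equation at x holds. *)

(** A list [L] is a formal combination of equations, repetitions allowed: at [k = f] this is its
    right-hand side, at [incidence K h u] the coefficient of the unknown [u]. *)
Definition eval_comb (K : fieldType) (T : Type) (L : seq (T * K)) (k : T -> K) : K :=
  \sum_(p <- L) p.2 * k p.1.

Definition incidence (K : fieldType) (I T : Type) (S : eqType) (h : I -> T -> S)
    (u : I * S) (x : T) : K := (h u.1 x == u.2)%:R.

Definition scale_comb (K : fieldType) (T : Type) (a : K) (L : seq (T * K)) :=
  [seq (p.1, a * p.2) | p <- L].

(** Vanishing on every [k] expresses that [L] is formally zero, even if it repeats points. *)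
Definition independent_modulo (K : fieldType) (I T : Type) (S : eqType)
    (h : I -> T -> S) (D : set (I * S)) :=
  forall L : seq (T * K),
    (forall u, ~ D u -> eval_comb L (incidence K h u) = 0) ->
    forall k, eval_comb L k = 0.

Lemma eval_scale_comb (K : fieldType) (T : Type) (a : K) (L : seq (T * K)) k :
  eval_comb (scale_comb a L) k = a * eval_comb L k.
Proof.
rewrite /eval_comb big_map mulr_sumr; apply: eq_bigr => p _ /=.
by rewrite mulrA.
Qed.

Lemma sum_fiber (K : fieldType) (J S : eqType) (s : seq J) (c : J -> K)
    (a : J -> S) (G : S -> K) :
  \sum_(j <- s) c j * G (a j) =
  \sum_(t <- undup (map a s)) (\sum_(j <- s) c j * (a j == t)%:R) * G t.
Proof.
under [RHS]eq_bigr do rewrite mulr_suml.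
rewrite exchange_big /=; apply: eq_big_seq => j js.
rewrite (bigD1_seq (a j)) ?undup_uniq ?mem_undup ?map_f //=.
rewrite eqxx mulr1 big1 ?addr0 // => t /negPf tj.
by rewrite eq_sym tj mulr0 mul0r.
Qed.

(** Of two members of a chain the larger serves both, so induction on [s] needs only finitely many
    comparisons. *)
Lemma chain_covers_seq (U : eqType) (F : set (set U)) (D0 : set U) (s : seq U) :
  F D0 -> total_on F subset ->
  exists2 D, F D & {in s, forall u, (\bigcup_(E in F) E) u -> D u}.
Proof.
move=> FD0 totF; elim: s => [|v s [D FD sD]]; first by exists D0.
have [[E FE Ev]|nv] := pselect ((\bigcup_(E in F) E) v); last first.
  by exists D => // u; rewrite inE => /predU1P[->//|]; exact: sD.
have [DE|ED] := totF _ _ FD FE.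
  exists E => // u; rewrite inE => /predU1P[->//|us Fu].
  by apply: DE; exact: sD.
exists D => // u; rewrite inE => /predU1P[-> _|]; [exact: ED | exact: sD].
Qed.

Lemma incidence_supp (K : fieldType) (I : finType) (T : Type) (S : eqType)
    (h : I -> T -> S) (L : seq (T * K)) (u : I * S) :
  u \notin [seq (i, h i p.1) | p <- L, i <- enum I] ->
  eval_comb L (incidence K h u) = 0.
Proof.
case: u => i t; rewrite /eval_comb /incidence /=.
elim: L => [|p L IH]; first by rewrite big_nil.
rewrite /= mem_cat negb_or big_cons => /andP[np /IH ->].
case: eqP np => [<-|_ _]; last by rewrite mulr0 addr0.
by rewrite (map_f (fun i => (i, h i p.1))) ?mem_enum.
Qed.

Lemma maximal_independent_modulo (K : fieldType) (I : finType) (T : Type)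
    (S : eqType) (h : I -> T -> S) :
  independent_modulo K h set0 ->
  exists D, independent_modulo K h D /\
    forall E, D `<` E -> ~ independent_modulo K h E.
Proof.
move=> ind0; apply: Zorn_bigcup => F Find totF.
(* The empty chain has union [set0], which is where [ind0] is needed. *)
have [[D0 FD0]|F0] := pselect (F !=set0); last first.
  by rewrite bigcup0 // => D FD; case: F0; exists D.
move=> L suppL.
have [D FD DL] :=
  chain_covers_seq [seq (i, h i p.1) | p <- L, i <- enum I] FD0 totF.
apply: (Find D FD) => u Du.
have [uL|] := boolP (u \in [seq (i, h i p.1) | p <- L, i <- enum I]).
  by apply: suppL => /(DL _ uL).
exact: incidence_supp.
Qed.

Lemma maximal_independent_dual (K : fieldType) (I T : Type) (S : eqType)
    (h : I -> T -> S) (D : set (I * S)) (u : I * S) :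
  independent_modulo K h D ->
  (forall E, D `<` E -> ~ independent_modulo K h E) ->
  exists L : seq (T * K), forall v, ~ D v ->
    eval_comb L (incidence K h v) = `[<v = u>]%:R.
Proof.
move=> indD maxD; have [Du|Du] := pselect (D u).
  exists [::] => v Dv; rewrite /eval_comb big_nil asboolF // => vu.
  by apply: Dv; rewrite vu.
have /maxD : D `<` D `|` [set u].
  by split => [|sub]; [exact: subsetUl | apply: Du; apply: sub; right].
move=> /existsNP[L /not_implyP[suppL nzL]].
(* Otherwise [L] would be supported on [D] and hence trivial. *)
have Lu : eval_comb L (incidence K h u) != 0.
  apply/eqP => Lu0; apply: nzL; apply: indD => v Dv.
  by have [->//|vu] := pselect (v = u); apply: suppL => -[].
exists (scale_comb (eval_comb L (incidence K h u))^-1 L) => v Dv.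
rewrite eval_scale_comb; case: asboolP => [->|vu]; first by rewrite mulVf.
by rewrite (suppL v) ?mulr0 // => -[].
Qed.

Lemma independent_superposition (K : fieldType) (I : finType) (T : Type)
    (S : eqType) (h : I -> T -> S) (f : T -> K) :
  independent_modulo K h set0 ->
  exists g : I -> S -> K, forall x, f x = \sum_i g i (h i x).
Proof.
move=> /maximal_independent_modulo[D [indD maxD]].
have [L LE] := choice (fun u => maximal_independent_dual u indD maxD).
exists (fun i t => eval_comb (L (i, t)) f) => x.
pose M := (x, 1) :: flatten [seq scale_comb (-1) (L (i, h i x)) | i <- enum I].
have evalM k : eval_comb M k = k x - \sum_i eval_comb (L (i, h i x)) k.
  rewrite /eval_comb big_cons mul1r big_flatten big_map big_enum /= -sumrN.
  congr (_ + _); apply: eq_bigr => i _.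
  by rewrite -[LHS]/(eval_comb _ _) eval_scale_comb mulN1r.
apply/eqP; rewrite -subr_eq0 -evalM; apply/eqP; apply: indD => -[i t] Du.
rewrite evalM; under eq_bigr do rewrite (LE _ _ Du).
(* Unknowns with different first components differ, so only the combination attached to [(i, h i x)]
   can contribute at [(i, t)]. *)
rewrite (bigD1 i) //= big1 ?addr0; last first.
  by move=> j ji; case: asboolP => // -[ij]; rewrite ij eqxx in ji.
rewrite /incidence /=; apply/eqP; rewrite subr_eq0; apply/eqP; congr (_%:R).
by congr nat_of_bool; apply/eqP/asboolP => [->|[]].
Qed.

(** Collect the coefficients of equal points and drop those that cancel; a trivial [L] gives
    [n = 0]. *)
Lemma eval_comb_reduced (K : fieldType) (T : eqType) (L : seq (T * K)) :
  exists n (x : 'I_n -> T) (c : 'I_n -> K),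
    [/\ injective x, forall j, c j != 0 &
      forall k, eval_comb L k = \sum_(j < n) c j * k (x j)].
Proof.
pose c y := \sum_(p <- L) p.2 * (p.1 == y)%:R.
pose s := [seq y <- undup (map fst L) | c y != 0].
exists (size s), (tnth (in_tuple s)), (c \o tnth (in_tuple s)); split.
- by apply/tuple_uniqP; rewrite filter_uniq ?undup_uniq.
- by move=> j; have := mem_tnth j (in_tuple s); rewrite mem_filter => /andP[].
move=> k; rewrite /eval_comb (sum_fiber L snd fst) -/c.
rewrite -(big_tnth _ _ s xpredT (fun y => c y * k y)) big_filter.
rewrite [RHS]big_mkcond; apply: eq_bigr => y _.
by case: eqP => //= cy; rewrite -/(c y) cy mul0r.
Qed.

(** Grouping the indices by the value [t] of [a j], the coefficient of [G t] is the hypothesis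
    evaluated at [t]. *)
Lemma cycle_eval_sum (R : realType) (n : nat) (a lambda : 'I_n -> R) (G : R -> R) :
  (fun t : R => \sum_(j < n) lambda j * \1_[set a j] t) = cst 0 ->
  \sum_(j < n) lambda j * G (a j) = 0.
Proof.
move=> cyc; rewrite sum_fiber big1 // => t _.
have := congr1 (fun F => F t) cyc => /= cyct.
rewrite -[X in X * _](_ : \sum_(j < n) lambda j * \1_[set a j] t = _).
  by rewrite cyct mul0r.
by apply: eq_bigr => j _; rewrite indicE in_set1 eq_sym.
Qed.

Theorem theorem1p2 (R : realType) (d r : nat) (X : set 'rV[R]_d)
    (h : 'I_r -> X -> R) :
  superpositions h = [set: X -> R] <-> ~ (exists C : set X, is_cycle h C).
Proof.
split.
  move=> allX [C [n [x [lambda [n0 xinj _ lambda0 cyc]]]]].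
  pose j0 := Ordinal n0.
  (* The functional with weights [lambda] on the cycle kills every superposition, but takes the
     value [lambda j0] on this indicator. *)
  have : superpositions h (fun y => (y == x j0)%:R) by rewrite allX.
  move=> [g fE].
  have /eqP := lambda0 j0; apply.
  transitivity (\sum_(j < n) lambda j * (x j == x j0)%:R).
    rewrite (bigD1 j0) //= eqxx mulr1 big1 ?addr0 // => j /negPf jj0.
    by rewrite (inj_eq xinj) jj0 mulr0.
  under eq_bigr => j _ do rewrite (congr1 (fun F => F (x j)) fE) mulr_sumr.
  by rewrite exchange_big big1 // => i _; exact: cycle_eval_sum (cyc i).
move=> nocyc; apply/seteqP; split => // f _.
suff /(independent_superposition f)[g fE] : independent_modulo R h set0.
  by exists g; apply/funext.
move=> L suppL k; have [n [x [c [xinj c0 LE]]]] := eval_comb_reduced L.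
(* If any point survives the reduction, the surviving points form a cycle with weights [c]. *)
rewrite LE; case: n x c xinj c0 LE => [|n] x c xinj c0 LE.
  by rewrite big_ord0.
case: nocyc; exists (range x), n.+1, x, c; split => // i.
apply/funext => t; transitivity (eval_comb L (incidence R h (i, t))); last exact: suppL.
rewrite LE.
by apply: eq_bigr => j _; rewrite indicE in_set1 eq_sym.
Qed.
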